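(* Let $G=(V,E)$ be a graph on $n$ vertices of diameter at most two, let $\bar\omega_1,\dots,\bar\omega_n\in\mathbb{R}$ with $\sum_{i=1}^n\bar\omega_i=0$, let $\vec\phi^{\,0}\in\mathbb{R}^n$ be an initial condition, and let $D$ be a constant with $D_0\le D<\pi$, where $D_t=\max_i\phi_i^t-\min_i\phi_i^t$. Let $(K_{ij})_{ij\in E}$ be a solution of the following optimization problem in the nonnegative variables $K_{ij}=K_{ji}\ge 0$, $ij\in E$: minimize $\sum_{ij\in E}K_{ij}$ subject to $$|\bar\omega_k-\bar\omega_l|-\frac{2K_{kl}}{n}\sin D-\frac{\sin D}{n}\sum_{m\in N_{kl}}\bigl(\delta_m K_{km}+(1-\delta_m)K_{lm}\bigr)\le 0$$ for all $1\le k,l\le n$ and all choices of $\delta_m\in\{0,1\}$, $m\in N_{kl}$. Let $\vec\phi^{\,t}$, $t\ge0$, be the trajectory starting at $\vec\phi^{\,0}$ of the system $$\dot\phi_i=\bar\omega_i+\sum_{j\in N_i}\frac{K_{ij}}{n}\sin(\phi_j-\phi_i),\qquad i=1,\dots,n,$$ with these coupling strengths. Then, for all times $t\ge 0$ such that $D_t=D$, $$\dot\phi_k^t-\dot\phi_l^t=\bar\omega_k-\bar\omega_l-\sum_{i\in N_k}\frac{K_{ik}}{n}\sin(\phi_k^t-\phi_i^t)-\sum_{j\in N_l}\frac{K_{jl}}{n}\sin(\phi_j^t-\phi_l^t)\le 0$$ for every two oscillators $k$ and $l$ such that $\phi_k^t=\max_i\phi_i^t$ and $\phi_l^t=\min_i\phi_i^t$;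 and the system achieves frequency synchronization.
   Context: $G=(V,E)$ is a finite undirected graph with vertex set $V=\{1,\dots,n\}$ (the oscillators) and edge set $E$; its diameter is the maximum over pairs of vertices of the number of edges in a shortest path between them. $N_i$ is the set of neighbors of $i$ in $G$, and $N_{kl}=N_k\cap N_l$ is the set of common neighbors of $k$ and $l$. If there is no edge between $k$ and $l$, then $K_{kl}=0$ by convention in the constraints. For each pair $k,l$ there is one constraint for each of the $2^{|N_{kl}|}$ combinations of values of the $\delta_m$. Phases are real-valued (trajectories are considered in $\mathbb{R}^n$). The constants $\bar\omega_i=\omega_i-\frac1n\sum_{k=1}^n\omega_k$ are the deviations of constant, not necessarily equal, intrinsic frequencies $\omega_i\in\mathbb{R}$ from their average, so $\sum_i\bar\omega_i=0$. The system achieves frequency synchronization if all $\dot\phi_i(t)$ become equal as $t\to\infty$; since here $\sum_i\dot\phi_i=0$, this means $\dot\phi_i(t)\to 0$ as $t\to\infty$ for every $i=1,\dots,n$. *)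

(* Defs.v *)
From HB Require Import structures.
From mathcomp Require Import all_boot all_order all_algebra.
From mathcomp Require Import all_classical all_reals all_analysis.
Set Implicit Arguments.
Unset Strict Implicit.
Unset Printing Implicit Defensive.
Import Order.TTheory GRing.Theory Num.Theory.
Import numFieldNormedType.Exports.
Local Open Scope ring_scope.

(* A simple graph on T is a symmetric irreflexive relation e : rel T; it is   *)
(* disconnected exactly when no d satisfies is_diameter e d (for T nonempty). *)

Definition is_gpath (T : finType) (e : rel T) (x y : T) (p : seq T) : bool :=
  [&& path e x p, uniq (x :: p) & last x p == y].

Definition is_gdist (T : finType) (e : rel T) (x y : T) (d : nat) : Prop :=
  (exists2 p, is_gpath e x y p & size p = d) /\
  (forall p, is_gpath e x y p -> (d <= size p)%N).

Definition is_diameter (T : finType) (e : rel T) (d : nat) : Prop :=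
  (forall x y, exists2 k, is_gdist e x y k & (k <= d)%N) /\
  (exists x y, is_gdist e x y d).

Definition nbr (T : finType) (e : rel T) (i : T) : {set T} :=
  [set j | e i j]%SET.

Definition cnbr (T : finType) (e : rel T) (k l : T) : {set T} :=
  (nbr e k :&: nbr e l)%SET.

Section Oscillators.
Context {R : realType} {n : nat}.
Implicit Types (e : rel 'I_n.+1) (omega : 'I_n.+1 -> R) (K : 'M[R]_n.+1).

(* The number of oscillators is n.+1, so that maxima and minima are over a    *)
(* nonempty set.                                                              *)
Definition max_phase (phi : 'I_n.+1 -> R) : R :=
  \big[Num.max/phi ord0]_(i < n.+1) phi i.

Definition min_phase (phi : 'I_n.+1 -> R) : R :=
  \big[Num.min/phi ord0]_(i < n.+1) phi i.

Definition spread (phi : 'I_n.+1 -> R) : R := max_phase phi - min_phase phi.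

(* A family of coupling strengths indexed by the edges is encoded as a        *)
(* symmetric matrix that vanishes outside the edges. Only the values of delta *)
(* on the common neighbors of k and l matter.                                 *)
Definition feasible e omega (D : R) K : Prop :=
  [/\ forall i j, K i j = K j i,
      forall i j, ~~ e i j -> K i j = 0,
      forall i j, e i j -> 0 <= K i j &
      forall (k l : 'I_n.+1) (delta : 'I_n.+1 -> bool),
        `|omega k - omega l| - 2 * K k l / n.+1%:R * sin D
        - sin D / n.+1%:R *
          (\sum_(m in cnbr e k l)
             ((delta m)%:R * K k m + (1 - (delta m)%:R) * K l m)) <= 0].

(* Each undirected edge is counted once. *)
Definition total_coupling e K : R :=
  \sum_(i < n.+1) \sum_(j < n.+1 | (i < j)%N && e i j) K i j.

Definition optimal e omega (D : R) K : Prop :=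
  feasible e omega D K /\
  forall K', feasible e omega D K' ->
    total_coupling e K <= total_coupling e K'.

(* Difference quotients are restricted to times s >= 0: the derivative is     *)
(* two-sided at t > 0 and the right derivative at t = 0.                      *)
Definition velocity_flow (f : R -> R) (t : R) : set_system R :=
  ((f s - f t) / (s - t) @[s --> within `[0, +oo[%classic t^'])%classic.

Definition has_velocity (f : R -> R) (t v : R) : Prop :=
  (velocity_flow f t --> v)%classic.

Definition velocity (f : R -> R) (t : R) : R := lim (velocity_flow f t).

Definition is_trajectory e omega K (phi0 : 'I_n.+1 -> R)
    (phi : R -> 'I_n.+1 -> R) : Prop :=
  phi 0 = phi0 /\
  forall (t : R) (i : 'I_n.+1), 0 <= t ->
    has_velocity (fun s => phi s i) t
      (omega i + \sum_(j in nbr e i) K i j / n.+1%:R * sin (phi t j - phi t i)).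

(* The velocities of a trajectory sum to 0, so their only possible common     *)
(* limit is 0.                                                                *)
Definition frequency_sync (phi : R -> 'I_n.+1 -> R) : Prop :=
  forall i : 'I_n.+1,
    (velocity (fun s => phi s i) t @[t --> +oo] --> (0 : R))%classic.

End Oscillators.

(* Main.v *)
Require Import Defs.
From HB Require Import structures.
From mathcomp Require Import all_boot all_order all_algebra.
From mathcomp Require Import all_classical all_reals all_analysis.
From mathcomp Require Import ring lra.
Set Implicit Arguments.
Unset Strict Implicit.
Unset Printing Implicit Defensive.
Import Order.TTheory GRing.Theory Num.Theory.
Import numFieldNormedType.Exports.
Local Open Scope ring_scope.

(** Once the largest phase gap is [d] with [D <= d <= pi], the coupling through
    the edge between the extreme oscillators [k] and [l] and through their common
    neighbours pulls them together at a rate at least [c * sin d], where [c] is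
    [pair_coupling e K k l]. For a common neighbour [m] this is the inequality
    [min p q * sin (a + b) <= p * sin a + q * sin b], with [a] and [b] the gaps
    from [k] to [m] and from [m] to [l]; the remaining neighbours cannot push the
    extremes apart. Choosing in the constraints the [delta] that selects the
    smaller of [K k m] and [K l m] gives [omega k - omega l <= c * sin D]. At
    [d = D] this is the announced sign of the relative velocity
    ([field_gap_le], [frequency_gap_le]).

    That sign is only weak, and so does not by itself keep the gap below [D].
    But [sin] is 1-Lipschitz, so the relative velocity at gap [d] is at most
    [c * (d - D)] ([field_gap_Lipschitz]). A Gronwall argument applies: the
    barrier [D + eps * exp (L * t)], with [L] above every [c], grows strictly faster than any
    gap touching it, so no gap crosses it ([stays_below]), and [eps -> 0] gives
    a gap at most [D] at all times ([phase_gap_le]).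

    Since [K] is symmetric, the system is the gradient flow of
    [- sum_i omega_i x_i - (2 N)^-1 sum_ij K_ij cos (x_j - x_i)], which
    decreases along the trajectory at rate [sum_i F_i ^ 2], the [F_i] being the
    velocities ([potential_derive]). As the frequencies sum to zero, this
    potential depends on phase differences only, hence is bounded below along
    the trajectory ([potential_ge]), while each velocity is Lipschitz in time
    ([field_along_Lipschitz]). A velocity that returned to size [eps] at
    arbitrarily late times would each time spend a fixed amount of potential,
    which is impossible ([dissipation_cvg0]). *)

(** * Trigonometric inequalities *)
Section Sine.
Context {R : realType}.
Implicit Types x y a b p q : R.

Lemma sin_sub_le x y : x <= y -> sin x - sin y <= y - x.
Proof.
move=> xy.
have [c _ E] : exists2 c, c \in `[x, y] & sin y - sin x = cos c * (y - x).
  apply: (MVT_segment xy).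
  by apply: continuous_subspaceT; exact: continuous_sin.
rewrite -opprB E -mulNr; have := cos_geN1 c; nra.
Qed.

(** A common neighbour splits the gap of the extreme oscillators into [a] and
    [b]; [sin] is subadditive on [[0, pi]], and the common factor [min p q] is
    all that remains of the two couplings. *)
Lemma min_mul_sinD_le a b p q : 0 <= a -> 0 <= b -> a + b <= pi ->
  0 <= p -> 0 <= q -> Num.min p q * sin (a + b) <= p * sin a + q * sin b.
Proof.
move=> a0 b0 abpi p0 q0.
have sa : 0 <= sin a by apply: sin_ge0_pi; apply/andP; split => //; lra.
have sb : 0 <= sin b by apply: sin_ge0_pi; apply/andP; split => //; lra.
have subadd : sin (a + b) <= sin a + sin b.
  by rewrite sinD; have := cos_le1 a; have := cos_le1 b; nra.
have m0 : 0 <= Num.min p q by rewrite le_min p0.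
have mp : Num.min p q <= p by rewrite ge_min lexx.
have mq : Num.min p q <= q by rewrite ge_min lexx orbT.
nra.
Qed.

End Sine.

(** * The vector field between extreme oscillators *)

Section Field.
Context {R : realType} {n : nat}.
Implicit Types (e : rel 'I_n.+1) (omega x : 'I_n.+1 -> R) (K : 'M[R]_n.+1).

(** The sum runs over all oscillators: couplings vanish outside the edges. *)
Definition kuramoto_field omega K x (i : 'I_n.+1) : R :=
  omega i + \sum_j K i j / n.+1%:R * sin (x j - x i).

Lemma sum_nbr e (i : 'I_n.+1) (F : 'I_n.+1 -> R) :
  (forall j, ~~ e i j -> F j = 0) -> \sum_(j in nbr e i) F j = \sum_j F j.
Proof.
move=> F0; rewrite [RHS](bigID (mem (nbr e i))) /= [X in _ + X]big1 ?addr0 //.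
by move=> j; rewrite inE => /F0.
Qed.

(** The constraints for [k] and [l] say [|omega k - omega l| <= c * sin D] for
    each choice of [delta]; this is the smallest such [c]. *)
Definition pair_coupling e K (k l : 'I_n.+1) : R :=
  (2 * K k l + \sum_(m in cnbr e k l) Num.min (K k m) (K l m)) / n.+1%:R.

Lemma coupling_ge0 e omega D K i j : feasible e omega D K -> 0 <= K i j.
Proof.
by case=> _ K0 Kp _; have [/Kp|/K0->] := boolP (e i j).
Qed.

Lemma pair_coupling_ge0 e omega D K k l :
  feasible e omega D K -> 0 <= pair_coupling e K k l.
Proof.
move=> feas; have K_ge0 i j : 0 <= K i j := coupling_ge0 i j feas.
rewrite /pair_coupling divr_ge0 // addr_ge0 ?mulr_ge0 //.
by apply: sumr_ge0 => m _; rewrite le_min !K_ge0.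
Qed.

Lemma frequency_gap_le e omega D K k l : feasible e omega D K ->
  omega k - omega l <= pair_coupling e K k l * sin D.
Proof.
case=> _ _ _ /(_ k l (fun m => K k m <= K l m)) feas.
apply: le_trans (ler_norm _) _; rewrite -subr_le0; apply: le_trans _ feas.
rewrite le_eqVlt; apply/orP; left; apply/eqP; rewrite /pair_coupling.
rewrite (eq_bigr (fun m => (K k m <= K l m)%R%:R * K k m
    + (1 - (K k m <= K l m)%R%:R) * K l m)).
  by field; rewrite nat1r pnatr_eq0.
move=> m _; rewrite minElt leNgt; case: ltgtP => //= [_|_|->]; lra.
Qed.

(** Both sums over neighbours are compared index by index: an index [i]
    contributes [K k l] if it is an extreme oscillator and the minimum of its
    two couplings if it is a common neighbour; any other index contributes a
    nonnegative amount, as all phases lie in an interval of length at most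
    [pi]. *)
Lemma field_gap_le e omega D K x k l : irreflexive e ->
  feasible e omega D K -> (forall i, x l <= x i <= x k) -> x k - x l <= pi ->
  kuramoto_field omega K x k - kuramoto_field omega K x l
    <= omega k - omega l - pair_coupling e K k l * sin (x k - x l).
Proof.
move=> e_irr feas xlk kl_pi.
have K_ge0 i j : 0 <= K i j := coupling_ge0 i j feas.
have [K_sym K_off _ _] := feas.
set s := sin _.
pose c i := (if i == l then K k l else 0) + (if i == k then K k l else 0)
  + (if i \in cnbr e k l then Num.min (K k i) (K l i) else 0).
have le_c i : c i * s <= K k i * sin (x k - x i) + K l i * sin (x i - x l).
  have /andP[li ik] := xlk i.
  have split_kl : x k - x l = (x k - x i) + (x i - x l) by ring.
  have Kkk : K k k = 0 by rewrite K_off ?e_irr.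
  have Kll : K l l = 0 by rewrite K_off ?e_irr.
  have ge0 : 0 <= K k i * sin (x k - x i) + K l i * sin (x i - x l).
    by apply: addr_ge0; apply: mulr_ge0 => //; apply: sin_ge0_pi;
      apply/andP; split; lra.
  rewrite /c !inE; have [-> | nil] := eqVneq i l; have [il|nik] := eqVneq _ k.
  - by rewrite il in Kll *; rewrite e_irr /= !subrr sin0 Kkk !addr0 mul0r mulr0.
  - by rewrite e_irr andbF !addr0 subrr sin0 Kll mul0r addr0.
  - by rewrite il e_irr /= addr0 add0r subrr sin0 Kkk mul0r add0r K_sym.
  - rewrite !add0r; case: ifP => _; last by rewrite mul0r.
    rewrite /s split_kl; apply: min_mul_sinD_le => //; lra.
have : \sum_i c i * s
    <= \sum_i (K k i * sin (x k - x i) + K l i * sin (x i - x l)).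
  by apply: ler_sum => i _; exact: le_c.
have -> : \sum_i c i * s = pair_coupling e K k l * s * n.+1%:R.
  rewrite -mulr_suml !big_split /= -!big_mkcond !big_pred1_eq /pair_coupling.
  by field; rewrite nat1r pnatr_eq0.
rewrite -ler_pdivlMr ?ltr0n // => le_sum.
rewrite /kuramoto_field.
have -> : \sum_j K k j / n.+1%:R * sin (x j - x k) =
    - (\sum_j K k j * sin (x k - x j)) / n.+1%:R.
  rewrite mulNr mulr_suml -sumrN; apply: eq_bigr => j _.
  by rewrite -opprB sinN; ring.
have -> : \sum_j K l j / n.+1%:R * sin (x j - x l) =
    (\sum_j K l j * sin (x j - x l)) / n.+1%:R.
  by rewrite mulr_suml; apply: eq_bigr => j _; ring.
rewrite big_split /= mulrDl in le_sum; rewrite mulNr.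
move: le_sum; set A := _ / _; set B := _ / _; set C := _ * _.
move: A B C => A B C le_sum; lra.
Qed.

(** The feasible couplings balance the frequencies at gap [D], and a larger gap
    weakens the attraction by no more than a linear term, even beyond
    [pi / 2] where [sin] decreases. *)
Lemma field_gap_Lipschitz e omega D K x k l : irreflexive e ->
  feasible e omega D K -> (forall i, x l <= x i <= x k) ->
  D <= x k - x l <= pi ->
  kuramoto_field omega K x k - kuramoto_field omega K x l
    <= pair_coupling e K k l * (x k - x l - D).
Proof.
move=> e_irr feas xlk /andP[D_le le_pi].
apply: le_trans (field_gap_le e_irr feas xlk le_pi) _.
have c_ge0 := pair_coupling_ge0 k l feas.
have := ler_wpM2l c_ge0 (sin_sub_le D_le); have := frequency_gap_le k l feas.
lra.
Qed.

End Field.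
(** * Barriers and dissipation *)

Section Analysis.
Context {R : realType}.
Local Open Scope classical_set_scope.
Local Open Scope ring_scope.

Lemma gt_left_of_decreasing (f : R -> R) (t d : R) :
  is_derive t 1 f d -> d < 0 -> \forall s \near t^'-, f t < f s.
Proof.
move=> [f_der f_val] d_lt0.
have q_cvg : (h^-1 *: (f (h + t) - f t) @[h --> 0^'] --> d)%classic.
  rewrite -f_val; move: (f_der : _ --> 'D_1 f t).
  by under eq_fun do rewrite /= [_ *: 1]mulr1.
have : \forall h \near (0:R)^', h^-1 *: (f (h + t) - f t) < 0.
  exact: (cvgr_lt d q_cvg).
move=> /nbhs_ballP[/= r r0 near_lt].
near=> s.
have s_lt : s < t by near: s; exact: nbhs_left_lt.
have s_gt : t - r < s by near: s; apply: nbhs_left_gt; lra.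
have := near_lt (s - t); rewrite /ball /= sub0r normrN ltr0_norm ?subr_lt0 //.
rewrite subrK => /(_ _ _) q_lt0.
have {}q_lt0 : (s - t)^-1 *: (f s - f t) < 0.
  by apply: q_lt0; [lra | rewrite subr_eq0 lt_eqF].
move: q_lt0; have : (s - t)^-1 < 0 by rewrite invr_lt0 subr_lt0.
rewrite /GRing.scale /=; nra.
Unshelve. all: by end_near. Qed.

(** At the first time when some [g p] fails to be negative, that [g p] vanishes
    and has a negative derivative, so it was already positive slightly
    earlier. *)
Lemma stays_below (I : finType) (g : I -> R -> R) (T : R) :
  (forall p, continuous (g p)) -> (forall p, g p 0 < 0) ->
  (forall p (t : R), 0 < t <= T -> (forall q, g q t <= 0) -> g p t = 0 ->
     exists2 d, d < 0 & is_derive t 1 (g p) d) ->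
  forall p t, 0 <= t <= T -> g p t < 0.
Proof.
move=> g_cont g0 g_der.
have [T_lt0|T_ge0] := ltP T 0; first by move=> p t /andP[? ?]; lra.
(* The supremum of S is the first exit time, capped at T. *)
pose S := [set t : R | 0 <= t <= T /\
  forall (s : R) p, 0 <= s <= t -> g p s < 0]%classic.
have S0 : S 0.
  split=> [|s p]; first by rewrite lexx.
  by rewrite -eq_le => /eqP <-.
have S_ub : ubound S T by move=> t [/andP[]].
have S_sup : has_sup S by split; [exists 0 | exists T].
have sup_ge0 : 0 <= sup S by exact: sup_upper_bound.
have sup_leT : sup S <= T by apply: ge_sup => //; exists 0.
have below (s : R) p : 0 <= s < sup S -> g p s < 0.
  move=> /andP[s0 s_sup].
  have [|t [_ St] ?] := sup_adherent (eps := sup S - s) _ S_sup.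
    by rewrite subr_gt0.
  by apply: St; apply/andP; split; lra.
have at_sup p : g p (sup S) < 0.
  move: sup_ge0; rewrite le_eqVlt => /orP[/eqP <- //|sup_gt0].
  have le0 q : g q (sup S) <= 0.
    rewrite leNgt; apply/negP => gt0.
    have near_gt : \forall s \near sup S, 0 < g q s.
      exact: (cvgr_gt (g q (sup S)) (g_cont q (sup S))).
    have near_left : \forall s \near (sup S)^'-, 0 < g q s.
      exact: cvg_at_left_filter near_gt.
    have [s [s1 s2 s3]] : exists s, [/\ 0 < s, s < sup S & 0 < g q s].
      apply: (@filter_ex _ (sup S)^'-); near=> s; split; near: s.
      - exact: nbhs_left_gt.
      - exact: nbhs_left_lt.
      - exact: near_left.
    by have := below s q; rewrite (ltW s1) s2 => /(_ isT); rewrite ltNge ltW.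
  rewrite lt_neqAle le0 andbT; apply/eqP => eq0.
  have [|d d_lt0 d_der] := g_der p (sup S) _ le0 eq0; first by rewrite sup_gt0.
  have [s [s1 s2 s3]] : exists s, [/\ 0 < s, s < sup S & g p (sup S) < g p s].
    apply: (@filter_ex _ (sup S)^'-); near=> s; split; near: s.
    - exact: nbhs_left_gt.
    - exact: nbhs_left_lt.
    - exact: gt_left_of_decreasing d_der d_lt0.
  have := below s p; rewrite (ltW s1) s2 => /(_ isT).
  by rewrite ltNge -eq0 ltW.
have [sup_eqT|sup_ltT] := eqVneq (sup S) T.
  move=> p t; rewrite -sup_eqT => /andP[t0].
  rewrite le_eqVlt => /orP[/eqP ->|t_sup]; first exact: at_sup.
  by apply: below; rewrite t0.
exfalso.
have near_sup p : \forall s \near sup S, g p s < 0.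
  exact: (cvgr_lt (g p (sup S)) (g_cont p (sup S))).
have : \forall s \near sup S, forall p, g p s < 0.
  exact: filter_forall near_sup.
move=> /nbhs_ballP[/= r r0 near_lt].
pose t := Num.min T (sup S + r / 2).
have sup_lt_t : sup S < t.
  by rewrite lt_min lt_neqAle sup_ltT sup_leT /= ltrDl divr_gt0.
have : t <= sup S.
  apply: sup_upper_bound => //; split.
    by rewrite ge_min lexx andbT (le_trans sup_ge0) // ltW.
  move=> s p /andP[s0 st].
  have [s_lt|s_ge] := ltP s (sup S); first by apply: below; rewrite s0.
  apply: near_lt; rewrite /ball /= distrC ger0_norm ?subr_ge0 //.
  have : t <= sup S + r / 2 by rewrite /t ge_min lexx orbT.
  lra.
by rewrite leNgt sup_lt_t.
Unshelve. all: by end_near. Qed.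

Lemma MVT_positive (f df : R -> R) (s t : R) :
  (forall z : R, 0 < z -> is_derive z 1 f (df z)) -> 0 < s -> s <= t ->
  exists2 c, c \in `[s, t] & f t - f s = df c * (t - s).
Proof.
move=> f_der s0 st; apply: MVT_segment => // [z|].
  by rewrite in_itv /= => /andP[sz _]; apply: f_der; exact: lt_trans sz.
apply: derivable_within_continuous => z; rewrite in_itv /= => /andP[sz _].
by have [] := f_der z (lt_le_trans s0 sz).
Qed.

(** A form of Barbalat's lemma: if [eps <= |v t|], then [|v|] stays above
    [eps / 2] for a time [del = eps / (2 L)], during which [V] falls by at
    least [del * (eps / 2) ^ 2]. Late enough, [V] is closer than that to its
    infimum. *)
Lemma dissipation_cvg0 (V dV v : R -> R) (a L : R) :
  (forall t : R, 0 < t -> is_derive t 1 V (dV t)) ->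
  (forall t : R, 0 < t -> dV t <= - v t ^+ 2) ->
  (forall t : R, 0 < t -> a <= V t) ->
  0 < L -> (forall s t : R, 0 < s -> s <= t -> `|v t - v s| <= L * (t - s)) ->
  (v t @[t --> +oo] --> (0 : R))%classic.
Proof.
move=> V_der dV_le V_ge L_gt0 v_lip.
have mvt s t := MVT_positive (s := s) (t := t) V_der.
pose E := [set V t | t in [set t : R | 0 < t]]%classic.
have E_inf : has_inf E.
  split; first by exists (V 1), 1 => //=.
  by exists a => _ [t t0 <-]; exact: V_ge.
apply/cvgrPdist_lt => eps eps0.
pose del := eps / (2 * L).
have del0 : 0 < del by rewrite divr_gt0 // mulr_gt0.
have [|_ [T T0 <-] VT] := inf_adherent (eps := del * (eps / 2) ^+ 2) _ E_inf.
  by rewrite mulr_gt0 // exprn_gt0 // divr_gt0.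
near=> t.
have Tt : T <= t by near: t; apply: nbhs_pinfty_ge; exact: num_real.
have t0 : 0 < t by exact: lt_le_trans Tt.
rewrite sub0r normrN ltNge; apply/negP => v_ge.
have Vt : V t <= V T.
  have [c] := mvt T t T0 Tt; rewrite in_itv /= => /andP[Tc _].
  have := dV_le c (lt_le_trans T0 Tc); have := sqr_ge0 (v c); nra.
have tdel : t <= t + del by lra.
have inf_le : inf E <= V (t + del).
  apply: ge_inf; first by case: E_inf.
  by exists (t + del) => //=; rewrite addr_gt0.
have [c] := mvt t (t + del) t0 tdel; rewrite in_itv /= => /andP[tc ct] Vdel.
have vc : eps / 2 <= `|v c|.
  have := v_lip t c t0 tc; have := ler_distD (v c) (v t) 0.
  rewrite !subr0 distrC => ? ?.
  have : L * (c - t) <= eps / 2; last by lra.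
  have -> : eps / 2 = L * del by rewrite /del; field; rewrite gt_eqF.
  by rewrite ler_pM2l //; lra.
have vc2 : (eps / 2) ^+ 2 <= v c ^+ 2.
  by rewrite -[v c ^+ 2]real_normK ?num_real // ler_pXn2r // ?nnegrE //; lra.
have := dV_le c (lt_le_trans t0 tc).
have dE : t + del - t = del by ring.
rewrite dE in Vdel; move: VT Vdel; set X := (eps / 2) ^+ 2 in vc2 *.
nra.
Unshelve. all: by end_near. Qed.

End Analysis.
(** * From one-sided velocities to derivatives *)

Section Trajectory.
Context {R : realType}.
Local Open Scope classical_set_scope.
Local Open Scope ring_scope.
Implicit Types (f : R -> R) (s t v : R).

Lemma within_ge0_dnbhs_proper t :
  0 <= t -> ProperFilter (within `[0, +oo[ t^').
Proof.
move=> t_ge0; apply: Build_ProperFilter_ex => P.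
rewrite /within /dnbhs /within /= => /nbhs_ballP[/= r r0 rP].
exists (t + r / 2); apply: rP.
- rewrite /ball /= opprD addrA subrr add0r normrN gtr0_norm; lra.
- by rewrite /= gt_eqF //; lra.
- by rewrite /= in_itv /= andbT; lra.
Qed.

Lemma velocityE f t v : 0 <= t -> has_velocity f t v -> velocity f t = v.
Proof.
move=> t_ge0 fv; have ? := within_ge0_dnbhs_proper t_ge0.
exact: (cvg_lim (@Rhausdorff R) fv).
Qed.

Lemma has_velocity_continuous f t v : has_velocity f t v ->
  f s @[s --> within `[0, +oo[ (nbhs t)] --> f t.
Proof.
move=> fv.
have f_dnbhs : f s @[s --> within `[0, +oo[ t^'] --> f t.
  have : f t + (f s - f t) / (s - t) * (s - t) @[s --> within `[0, +oo[ t^']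
      --> f t + v * (t - t).
    apply: cvgD; first exact: cvg_cst.
    apply: cvgM; first exact: fv.
    apply: cvgB; last exact: cvg_cst.
    move=> A /nbhs_dnbhs; exact: cvg_within.
  rewrite subrr mulr0 addr0; apply: cvg_trans; apply: near_eq_cvg.
  rewrite near_withinE /dnbhs near_withinE; apply: nearW => s /= s_neq _.
  by rewrite divfK ?subr_eq0 // addrC subrK.
move=> A fA.
have A_dnbhs : nbhs t (fun s => s != t -> `[0, +oo[%classic s -> A (f s)) :=
  f_dnbhs A fA.
suff : nbhs t (fun s => `[0, +oo[%classic s -> A (f s)) by [].
apply: filterS A_dnbhs => s sA s_ge0; have [->|s_neq] := eqVneq s t.
  exact: nbhs_singleton.
exact: sA.
Qed.

(** Freezing a function at its initial value for negative times makes it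
    continuous on the whole line and leaves its values at nonnegative times and
    its derivatives at positive times unchanged; this removes the one-sided
    limits at time [0]. *)
Lemma continuous_extension f :
  (forall t, 0 <= t -> exists v, has_velocity f t v) ->
  continuous (fun t => f (Num.max t 0)).
Proof.
move=> f_vel t; have [|v /has_velocity_continuous] := f_vel (Num.max t 0).
  by rewrite le_max lexx orbT.
apply: cvg_comp => A A_near.
have max_cvg : Num.max s 0 @[s --> t] --> Num.max t 0.
  by apply: continuous_max; [exact: cvg_id | exact: cvg_cst].
have A_max : nbhs t (fun s =>
    `[0, +oo[%classic (Num.max s 0) -> A (Num.max s 0)) := max_cvg _ A_near.
suff : nbhs t (fun s => A (Num.max s 0)) by [].
apply: filterS A_max => s; apply.
by rewrite /= in_itv /= andbT le_max lexx orbT.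
Qed.

Lemma derive_extension f t v : 0 < t -> has_velocity f t v ->
  is_derive t 1 (fun s => f (Num.max s 0)) v.
Proof.
move=> t_gt0 fv; set g := fun s => _.
suff q_cvg : h^-1 *: ((g \o shift t) (h *: 1) - g t) @[h --> 0^'] --> v.
  apply: DeriveDef; first by apply/cvg_ex; exists v.
  exact: (cvg_lim (@Rhausdorff R) q_cvg).
have gt : g t = f t by rewrite /g max_l // ltW.
have shift_cvg : h + t @[h --> 0^'] --> within `[0, +oo[ t^'.
  move=> A /=; rewrite /nbhs /= /within /dnbhs /within /=.
  move=> /nbhs_ballP[/= r r0 rA].
  apply/nbhs_ballP; exists (Num.min r t) => /=; first by rewrite lt_min r0.
  move=> h; rewrite /ball /= sub0r normrN lt_min => /andP[hr ht] h0.
  apply: rA.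
  - by rewrite /ball /= opprD addrCA subrr addr0 normrN.
  - by rewrite -subr_eq0 addrK.
  - by rewrite /= in_itv /= andbT; have := ler_norm (- h); rewrite normrN; lra.
have : (f (h + t) - f t) / (h + t - t) @[h --> 0^'] --> v :=
  cvg_comp _ _ shift_cvg fv.
apply: cvg_trans; apply: near_eq_cvg; apply/nbhs_ballP; exists t => //= h.
rewrite /ball /= sub0r normrN => ht h0; rewrite gt /g [_ *: 1]mulr1 max_l.
  by rewrite addrK mulrC.
by have := ler_norm (- h); rewrite normrN; lra.
Qed.

End Trajectory.
(** * Invariance of the spread and decay of the velocities *)

Section Dynamics.
Context {R : realType} {n : nat}.
Local Open Scope classical_set_scope.
Local Open Scope ring_scope.
Context (e : rel 'I_n.+1) (omega : 'I_n.+1 -> R) (K : 'M[R]_n.+1) (D : R).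
Context (psi : R -> 'I_n.+1 -> R).
Context (e_irr : irreflexive e).
Context (feas : feasible e omega D K).
Context (psi_cont : forall i, continuous (psi^~ i)).
Context (psi_der : forall (t : R) i, 0 < t ->
  is_derive t 1 (psi^~ i) (kuramoto_field omega K (psi t) i)).
Context (D_ltpi : D < pi).
Context (psi0 : forall i j, psi 0 i - psi 0 j <= D).

(** Gronwall's argument for finitely many gaps at once. A gap that touches the
    barrier [D + eps * exp (L * s)] while no other exceeds it is the gap of the
    extreme oscillators, so its velocity is at most
    [pair_coupling e K k l * (eps * exp (L * s))], less than the slope of the
    barrier. The barrier must stay below [pi] up to time [t], which holds for
    small [eps]. *)
Lemma phase_gap_le (t : R) i j : 0 <= t -> psi t i - psi t j <= D.
Proof.
move=> t_ge0.
pose C := \sum_k \sum_l pair_coupling e K k l.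
have c_ge0 k l : 0 <= pair_coupling e K k l := pair_coupling_ge0 k l feas.
have C_ge k l : pair_coupling e K k l <= C.
  rewrite /C (bigD1 k) //= (bigD1 l) //= -addrA lerDl addr_ge0 //.
    by apply: sumr_ge0.
  by apply: sumr_ge0 => ? _; apply: sumr_ge0.
pose L := C + 1.
pose g (p : 'I_n.+1 * 'I_n.+1) (eps s : R) :=
  psi s p.1 - psi s p.2 - (D + eps * expR (L * s)).
have g_lt0 eps : 0 < eps -> eps * expR (L * t) < pi - D -> g (i, j) eps t < 0.
  move=> eps0 eps_small; apply: (@stays_below _ _ (fun p => g p eps) t).
  - move=> p s; apply: cvgB; first by apply: cvgB; exact: psi_cont.
    apply: cvgD; first exact: cvg_cst.
    apply: cvgM; first exact: cvg_cst.
    apply: (@cvg_comp _ _ _ (fun s => L * s) expR); last exact: continuous_expR.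
    by apply: cvgM; [exact: cvg_cst | exact: cvg_id].
  - move=> p; rewrite /g mulr0 expR0 mulr1; have := psi0 p.1 p.2; lra.
  - move=> [k l] s /andP[s_gt0 s_le] g_le0 g_eq0.
    have eE : 0 < eps * expR (L * s) by rewrite mulr_gt0 ?expR_gt0.
    have lk m : psi s l <= psi s m <= psi s k.
      have := g_le0 (k, m); have := g_le0 (m, l); move: g_eq0.
      by rewrite /g /= => ? ? ?; apply/andP; split; lra.
    have eE_le : eps * expR (L * s) <= eps * expR (L * t).
      rewrite ler_pM2l // ler_expR ler_wpM2l // /L addr_ge0 //.
      exact: le_trans (c_ge0 k l) (C_ge k l).
    have gapE : psi s k - psi s l = D + eps * expR (L * s).
      by move: g_eq0; rewrite /g /=; lra.
    have := field_gap_Lipschitz e_irr feas lk; rewrite gapE.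
    have -> : D <= D + eps * expR (L * s) <= pi by apply/andP; split; lra.
    move=> /(_ isT); rewrite [D + _ - D]addrAC subrr add0r => F_le.
    exists (kuramoto_field omega K (psi s) k - kuramoto_field omega K (psi s) l
       - eps * (expR (L * s) * L)).
      have := ler_wpM2r (ltW eE) (C_ge k l); rewrite /L; nra.
    have expd : is_derive s 1 (fun s => expR (L * s)) (expR (L * s) * L).
      apply: (@is_derive1_comp _ expR (fun s => L * s)).
      by apply: is_derive_eq; rewrite /GRing.scale /= mulr1.
    have dk := psi_der k s_gt0. have dl := psi_der l s_gt0.
    have -> : (fun p => g p eps) (k, l) =
        psi^~ k - psi^~ l - (cst D + eps \*: (fun s => expR (L * s))).
      by apply/funext => u; rewrite /g /= !fctE.
    by apply: is_derive_eq; rewrite add0r.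
  - by rewrite t_ge0 lexx.
rewrite leNgt; apply/negP => D_lt.
set E := expR (L * t) in g_lt0.
have E0 : 0 < E by exact: expR_gt0.
(* With eps = m / E the barrier at time t is D + m, below both pi and
   the gap. *)
pose m := Num.min (pi - D) (psi t i - psi t j - D) / 2.
have m0 : 0 < m.
  by apply: divr_gt0 => //; rewrite lt_min !subr_gt0 D_ltpi.
have m1 : m * 2 <= pi - D by rewrite /m divfK ?pnatr_eq0 // ge_min lexx.
have m2 : m * 2 <= psi t i - psi t j - D.
  by rewrite /m divfK ?pnatr_eq0 // ge_min lexx orbT.
have mE : m / E * E = m by rewrite divfK // gt_eqF.
have := g_lt0 (m / E); rewrite /g /= -/E mE.
have -> : 0 < m / E by rewrite divr_gt0.
have -> : m < pi - D by lra.
move=> /(_ isT isT); lra.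
Qed.

(** For symmetric [K] the field is minus the gradient of this function; the
    factor 2 accounts for each edge being counted in both directions. *)
Definition potential (x : 'I_n.+1 -> R) : R :=
  - \sum_i omega i * x i
  - (2 * n.+1%:R)^-1 * \sum_i \sum_j K i j * cos (x j - x i).

Lemma potential_derive (t : R) : 0 < t -> is_derive t 1 (potential \o psi)
  (- \sum_i kuramoto_field omega K (psi t) i ^+ 2).
Proof.
move=> t_gt0; set F := kuramoto_field omega K (psi t).
have dpsi i : is_derive t 1 (psi^~ i) (F i) := psi_der i t_gt0.
have dcos i j : is_derive t 1 (fun s => cos (psi s j - psi s i))
    (- sin (psi t j - psi t i) * (F j - F i)).
  exact: (@is_derive1_comp _ cos (psi^~ j - psi^~ i)).
have -> : potential \o psi = - (\sum_i omega i \*: psi^~ i)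
   - (2 * n.+1%:R)^-1 \*:
     \sum_i \sum_j K i j \*: (fun s => cos (psi s j - psi s i)).
  apply/funext => s; rewrite /potential /= !fctE !fct_sumE; congr (_ - _ * _).
  by apply: eq_bigr => i _; rewrite fct_sumE.
apply: is_derive_eq.
have [K_sym _ _ _] := feas.
have N0 : n.+1%:R != 0 :> R by rewrite pnatr_eq0.
pose S := \sum_i \sum_j K i j * sin (psi t j - psi t i) * F i.
(* Exchanging the two ends of each edge turns the sine around. *)
have S_swap : S = - \sum_i \sum_j K i j * sin (psi t j - psi t i) * F j.
  rewrite /S exchange_big -sumrN; apply: eq_bigr => i _.
  rewrite -sumrN; apply: eq_bigr => j _.
  by rewrite K_sym -(opprB (psi t j)) sinN; ring.
have -> : \sum_i \sum_j K i j *: (- sin (psi t j - psi t i) * (F j - F i))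
    = 2 * S.
  rewrite mulr_natl mulr2n {1}S_swap /S -sumrN -big_split /=.
  apply: eq_bigr => i _; rewrite -sumrN -big_split /=; apply: eq_bigr => j _.
  by rewrite /GRing.scale /=; ring.
have -> : \sum_i F i ^+ 2 = \sum_i omega i * F i + n.+1%:R^-1 * S.
  rewrite mulr_sumr -big_split /=; apply: eq_bigr => i _.
  rewrite expr2 {1}/F /kuramoto_field mulrDl; congr (_ + _).
  by rewrite mulr_sumr mulr_suml; apply: eq_bigr => j _; ring.
by rewrite /GRing.scale /=; field; rewrite nat1r pnatr_eq0.
Qed.


Lemma kuramoto_field_le x i :
  `|kuramoto_field omega K x i| <= `|omega i| + \sum_j K i j / n.+1%:R.
Proof.
apply: le_trans (ler_normD _ _) _; rewrite lerD2l.
apply: le_trans (ler_norm_sum _ _ _) _; apply: ler_sum => j _.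
have c_ge0 : 0 <= K i j / n.+1%:R.
  by rewrite divr_ge0 ?ler0n // (coupling_ge0 i j feas).
rewrite normrM (ger0_norm c_ge0) ler_piMr // ler_norml.
by rewrite sin_geN1 sin_le1.
Qed.

Lemma field_along_derive (t : R) i : 0 < t ->
  is_derive t 1 (fun s => kuramoto_field omega K (psi s) i)
    (\sum_j K i j / n.+1%:R * (cos (psi t j - psi t i) *
       (kuramoto_field omega K (psi t) j - kuramoto_field omega K (psi t) i))).
Proof.
move=> t_gt0; set F := kuramoto_field omega K (psi t).
have dpsi j : is_derive t 1 (psi^~ j) (F j) := psi_der j t_gt0.
have dsin j : is_derive t 1 (fun s => sin (psi s j - psi s i))
    (cos (psi t j - psi t i) * (F j - F i)).
  exact: (@is_derive1_comp _ sin (psi^~ j - psi^~ i)).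
have -> : (fun s => kuramoto_field omega K (psi s) i) = cst (omega i) +
    \sum_j (K i j / n.+1%:R) \*: (fun s => sin (psi s j - psi s i)).
  by apply/funext => s; rewrite /kuramoto_field !fctE fct_sumE.
by apply: is_derive_eq; rewrite add0r.
Qed.

(** The velocities are bounded by [kuramoto_field_le], and so is their
    derivative in time, which is linear in them with bounded coefficients. *)
Lemma field_along_Lipschitz i : exists2 L, 0 < L &
  forall s t : R, 0 < s -> s <= t ->
    `|kuramoto_field omega K (psi t) i - kuramoto_field omega K (psi s) i|
      <= L * (t - s).
Proof.
pose M := \sum_i (`|omega i| + \sum_j K i j / n.+1%:R).
have c_ge0 k l : 0 <= K k l / n.+1%:R.
  by rewrite divr_ge0 ?ler0n // (coupling_ge0 k l feas).
have F_le x k : `|kuramoto_field omega K x k| <= M.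
  apply: le_trans (kuramoto_field_le x k) _; rewrite /M.
  rewrite [leRHS](bigD1 k) //= lerDl.
  by apply: sumr_ge0 => l _; rewrite addr_ge0 ?sumr_ge0.
have M_ge0 : 0 <= M := le_trans (normr_ge0 _) (F_le (psi 0) i).
pose c := \sum_j K i j / n.+1%:R.
have c_sum_ge0 : 0 <= c by apply: sumr_ge0.
exists (c * (2 * M) + 1); first by rewrite ltr_wpDl ?mulr_ge0.
move=> s t s_gt0 st.
have [z _ ->] :=
  MVT_positive (fun z z_gt0 => field_along_derive i z_gt0) s_gt0 st.
rewrite normrM [`|t - s|]ger0_norm ?subr_ge0 // ler_wpM2r ?subr_ge0 //.
apply: le_trans (_ : c * (2 * M) <= _); last by rewrite lerDl.
apply: le_trans (ler_norm_sum _ _ _) _; rewrite /c mulr_suml.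
apply: ler_sum => j _; rewrite normrM (ger0_norm (c_ge0 _ _)) ler_wpM2l //.
rewrite normrM; apply: le_trans (_ : 1 * (2 * M) <= _); last by rewrite mul1r.
apply: ler_pM => //; first by rewrite ler_norml cos_geN1 cos_le1.
apply: le_trans (ler_normB _ _) _.
have := F_le (psi z) i; have := F_le (psi z) j; lra.
Qed.

(** The bound on the phases themselves that the linear term would call for is
    replaced by the bound on their gaps, because [omega] sums to zero. *)
Lemma potential_ge (x : 'I_n.+1 -> R) : \sum_i omega i = 0 ->
  (forall i j, x i - x j <= D) ->
  - (\sum_i `|omega i|) * D - (2 * n.+1%:R)^-1 * \sum_i \sum_j K i j
    <= potential x.
Proof.
move=> omega0 x_le; rewrite /potential lerB //.
  have -> : \sum_i omega i * x i = \sum_i omega i * (x i - x ord0).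
    under [RHS]eq_bigr do rewrite mulrBr.
    by rewrite sumrB -mulr_suml omega0 mul0r subr0.
  rewrite mulNr lerN2 mulr_suml; apply: ler_sum => i _.
  apply: le_trans (ler_norm _) _; rewrite normrM ler_wpM2l // ler_norml.
  by have := x_le i ord0; have := x_le ord0 i; lra.
rewrite ler_wpM2l ?invr_ge0 ?mulr_ge0 ?ler0n //.
apply: ler_sum => i _; apply: ler_sum => j _.
by rewrite ler_piMr ?cos_le1 // (coupling_ge0 i j feas).
Qed.

Lemma field_along_cvg0 i : \sum_i omega i = 0 ->
  (kuramoto_field omega K (psi t) i @[t --> +oo] --> (0 : R)).
Proof.
move=> omega0; have [L L_gt0 lip] := field_along_Lipschitz i.
apply: dissipation_cvg0 (fun t => potential_derive (t := t)) _ _ L_gt0 lip.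
- move=> t _; rewrite lerN2 (bigD1 i) //= lerDl.
  by apply: sumr_ge0 => j _; exact: sqr_ge0.
- move=> t t_gt0; apply: potential_ge omega0 _ => j k.
  by apply: phase_gap_le; exact: ltW.
Qed.

End Dynamics.
(** * Frequency synchronization *)

Lemma phase_le_spread (R : realType) (n : nat) (x : 'I_n.+1 -> R) i j :
  x i - x j <= spread x.
Proof.
by rewrite lerB //; [exact: le_bigmax | exact: bigmin_le].
Qed.

Theorem theorem2 (R : realType) (n : nat)
    (e : rel 'I_n.+1) (e_sym : symmetric e) (e_irr : irreflexive e)
    (diam : nat) (diamP : is_diameter e diam) (diam_le2 : (diam <= 2)%N)
    (omega : 'I_n.+1 -> R) (omega_sum0 : \sum_(i < n.+1) omega i = 0)
    (phi0 : 'I_n.+1 -> R)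
    (D : R) (D_ge : spread phi0 <= D) (D_ltpi : D < pi)
    (K : 'M[R]_n.+1) (K_opt : optimal e omega D K)
    (phi : R -> 'I_n.+1 -> R) (phiP : is_trajectory e omega K phi0 phi) :
  (forall t : R, 0 <= t -> spread (phi t) = D ->
     forall k l : 'I_n.+1,
       phi t k = max_phase (phi t) -> phi t l = min_phase (phi t) ->
       velocity (fun s => phi s k) t - velocity (fun s => phi s l) t
         = omega k - omega l
           - \sum_(i in nbr e k) K i k / n.+1%:R * sin (phi t k - phi t i)
           - \sum_(j in nbr e l) K j l / n.+1%:R * sin (phi t j - phi t l)
       /\ velocity (fun s => phi s k) t - velocity (fun s => phi s l) t <= 0)
  /\ frequency_sync phi.
Proof.
have [feas _] := K_opt; have [K_sym K_off _ _] := feas.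
have [phi_0 phi_vel] := phiP.
pose F := kuramoto_field omega K.
have vel t i : 0 <= t -> has_velocity (fun s => phi s i) t (F (phi t) i).
  move=> t_ge0; have := phi_vel t i t_ge0.
  by rewrite sum_nbr // => j /K_off ->; rewrite !mul0r.
have velE t i : 0 <= t -> velocity (fun s => phi s i) t = F (phi t) i.
  by move=> t_ge0; apply: velocityE => //; exact: vel.
split=> [t t_ge0 spreadD k l k_max l_min|i].
  rewrite !velE //; split.
    have -> : \sum_(i in nbr e k) K i k / n.+1%:R * sin (phi t k - phi t i) =
        - \sum_i K k i / n.+1%:R * sin (phi t i - phi t k).
      rewrite -sumrN sum_nbr => [|i /K_off ki0]; last first.
        by rewrite K_sym ki0 !mul0r.
      by apply: eq_bigr => i _; rewrite K_sym -opprB sinN mulrN.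
    have -> : \sum_(j in nbr e l) K j l / n.+1%:R * sin (phi t j - phi t l) =
        \sum_j K l j / n.+1%:R * sin (phi t j - phi t l).
      rewrite sum_nbr => [|j /K_off lj0]; last by rewrite K_sym lj0 !mul0r.
      by apply: eq_bigr => j _; rewrite K_sym.
    by rewrite /F /kuramoto_field; ring.
  have klD : phi t k - phi t l = D by rewrite k_max l_min.
  have lk i : phi t l <= phi t i <= phi t k.
    by rewrite k_max l_min le_bigmax bigmin_le.
  have := field_gap_Lipschitz e_irr feas lk.
  by rewrite klD subrr mulr0; apply; rewrite lexx ltW.
pose psi s i := phi (Num.max s 0) i.
have psiE s : 0 <= s -> psi s = phi s.
  by move=> s_ge0; apply/funext => j; rewrite /psi max_l.
have psi_cont j : continuous (psi^~ j).
  apply: (@continuous_extension _ (phi^~ j)) => t t_ge0.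
  by exists (F (phi t) j); exact: vel.
have psi_der (t : R) j : 0 < t -> is_derive t 1 (psi^~ j) (F (psi t) j).
  move=> t_gt0; rewrite psiE ?ltW //.
  by apply: (@derive_extension _ (phi^~ j)) => //; apply: vel; exact: ltW.
have psi0 j m : psi 0 j - psi 0 m <= D.
  by rewrite psiE // phi_0; exact: le_trans (phase_le_spread _ _ _) D_ge.
have := field_along_cvg0 e_irr feas psi_cont psi_der D_ltpi psi0 i omega_sum0.
apply: cvg_trans; apply: near_eq_cvg.
near=> t; have t_ge0 : 0 <= t.
  by near: t; apply: nbhs_pinfty_ge; exact: num_real.
by rewrite velE // psiE.
Unshelve. all: by end_near. Qed.
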